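(* Let $\mathcal{X}\subseteq\mathbb{R}^n$, $\mathcal{Y}\subseteq\mathbb{R}$, $\mathcal{Z}=\mathcal{X}\times\mathcal{Y}$, and let $d(z',z)=\|x'-x\|_r+\kappa|y'-y|$ for $z=(x,y)$, $z'=(x',y')$, where $r\in[1,\infty]$ and $\kappa\in(0,\infty)\cup\{\infty\}$. Let $f_\theta:\mathcal{X}\to\mathbb{R}$, $\gamma:[0,\infty)\to[0,\infty)$, and define $\bm{l}(x,y;\theta)=\gamma(|y-f_\theta(x)|)$. Suppose $F_\theta$ and $\Gamma$ are adversarial scores of $f_\theta$ and $\gamma$, respectively. (a) If $\kappa=\infty$, then $\mathcal{A}_\theta(t):=\Gamma(F_\theta(t))$ is an adversarial score of $\bm{l}(\cdot;\theta)$. (b) If $\kappa\in(0,\infty)$, then $\mathcal{A}_\theta(t):=\Gamma\big(\sup_{\tau\in[0,t]}\{F_\theta(t-\tau)+\kappa^{-1}\tau\}\big)$ is an adversarial score of $\bm{l}(\cdot;\theta)$.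
   Context: Convention: $0\cdot\infty=0$ (so for $\kappa=\infty$, $d(z',z)\le t<\infty$ iff $y'=y$ and $\|x'-x\|_r\le t$). $\|\cdot\|_r$ is the $r$-norm (absolute value on $\mathbb{R}$). Adversarial score: for $f:\mathcal{U}\subseteq\mathbb{R}^n\to\mathbb{R}^{\tilde n}$ put $\Delta_f(x,t)=\sup_{x'\in\mathcal{U}}\{\|f(x')-f(x)\|_r:\|x'-x\|_r\le t\}$. A function $F:[0,\infty)\to[0,\infty)$ is an adversarial score of $f$ if $F$ is non-decreasing and concave and $\sup_{x\in\mathcal{U}}\Delta_f(x,t)\le F(t)$ for all $t\ge0$ (for $\gamma$, $\mathcal{U}=[0,\infty)$). For the real-valued loss $\bm{l}(\cdot;\theta)$ on $(\mathcal{Z},d)$, an adversarial score is a non-decreasing concave $\mathcal{A}:[0,\infty)\to[0,\infty)$ with $\sup\{|\bm{l}(z';\theta)-\bm{l}(z;\theta)|: z,z'\in\mathcal{Z},\ d(z',z)\le t\}\le\mathcal{A}(t)$ for all $t\ge0$. *)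

(* Defs.v *)
From HB Require Import structures.
From mathcomp Require Import all_boot all_order all_algebra.
From mathcomp Require Import all_classical all_reals all_analysis.
Import Order.TTheory GRing.Theory Num.Theory.
Import numFieldNormedType.Exports.

Set Implicit Arguments.
Unset Strict Implicit.
Unset Printing Implicit Defensive.

Local Open Scope classical_set_scope.
Local Open Scope ring_scope.

(* The r-norm on R^n, meaningful for 1 <= r <= +oo; the value at -oo is junk.
   For r = +oo, the library's norm of a row vector is the largest absolute
   value of a coordinate. *)
Definition rnorm (R : realType) (n : nat) (r : \bar R) (x : 'rV[R]_n) : R :=
  match r with
  | p%:E => (\sum_(i < n) `|x ord0 i| `^ p) `^ p^-1
  | +oo%E => `|x|
  | -oo%E => 0
  end.

(* Functions on [0, +oo[ are total functions on R of which only the restriction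
   to [0, +oo[ matters. *)
Definition nondecreasing_concave (R : realType) (F : R -> R) : Prop :=
  [/\ {in `[0, +oo[, forall t, 0 <= F t},
      {in `[0, +oo[ &, {homo F : s t / s <= t}} &
      @convex_function R R^o `[0, +oo[%classic (fun t => - F t)].

(* The sup is taken in the extended reals. The norms on the source and on the
   target are parameters, so that R^n carries the r-norm and R the absolute
   value. *)
Definition adv_delta (R : realType) (V W : zmodType)
    (normV : V -> R) (normW : W -> R) (U : set V) (f : V -> W)
    (x : V) (t : R) : \bar R :=
  ereal_sup [set (normW (f x' - f x))%:E
            | x' in U `&` [set x' | normV (x' - x) <= t]].

Definition adversarial_score (R : realType) (V W : zmodType)
    (normV : V -> R) (normW : W -> R) (U : set V) (f : V -> W)
    (F : R -> R) : Prop :=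
  nondecreasing_concave F /\
  forall t : R, 0 <= t ->
    (ereal_sup [set adv_delta normV normW U f x t | x in U] <= (F t)%:E)%E.

(* In \bar R, +oo * 0 = 0 and +oo * c = +oo for c > 0. *)
Definition zdist (R : realType) (n : nat) (r kappa : \bar R)
    (z' z : 'rV[R]_n * R) : \bar R :=
  ((rnorm r (z'.1 - z.1))%:E + kappa * `|z'.2 - z.2|%:E)%E.

Definition adversarial_loss_score (R : realType) (T : Type)
    (d : T -> T -> \bar R) (Z : set T) (l : T -> R) (A : R -> R) : Prop :=
  nondecreasing_concave A /\
  forall t : R, 0 <= t ->
    (ereal_sup [set `|l p.1 - l p.2|%:E
               | p in [set p : T * T |
                        [/\ Z p.1, Z p.2 & (d p.1 p.2 <= t%:E)%E]]]
     <= (A t)%:E)%E.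

Definition loss (R : realType) (n : nat) (gamma : R -> R) (f : 'rV[R]_n -> R)
    (z : 'rV[R]_n * R) : R :=
  gamma `|z.2 - f z.1|.

(* Main.v *)
(* Each estimate follows from the reverse triangle inequality
     | |y' - f x'| - |y - f x| | <= |f x' - f x| + |y' - y|
   and the monotonicity of Gamma. For finite kappa, a pair at distance at most t
   has |y' - y| = tau / kappa for some tau in [0, t], which leaves t - tau for
   the r-norm of x' - x. The supremum in (b) is the sup-convolution of F_theta
   with a linear function, and sup-convolution preserves concavity. *)
Require Import Defs.
From HB Require Import structures.
From mathcomp Require Import all_boot all_order all_algebra.
From mathcomp Require Import all_classical all_reals all_analysis.
From mathcomp Require Import lra.
Import Order.TTheory GRing.Theory Num.Theory.
Import numFieldNormedType.Exports.

Set Implicit Arguments.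
Unset Strict Implicit.
Unset Printing Implicit Defensive.

Local Open Scope classical_set_scope.
Local Open Scope ring_scope.

Lemma rnorm_ge0 (R : realType) (n : nat) (r : \bar R) (x : 'rV[R]_n) :
  0 <= rnorm r x.
Proof. by case: r => [p||] //=; exact: powR_ge0. Qed.

(** This trades interval membership and bundled convexity weights for plain inequalities between
    reals, which [lra] can handle. *)
Lemma nondecreasing_concaveP (R : realType) (F : R -> R) :
  nondecreasing_concave F <->
  [/\ forall t, 0 <= t -> 0 <= F t,
      forall s t, 0 <= s -> s <= t -> F s <= F t &
      forall p s t, 0 <= p -> p <= 1 -> 0 <= s -> 0 <= t ->
        p * F s + (1 - p) * F t <= F (p * s + (1 - p) * t)].
Proof.
split=> [[F0 Fnd Fc]|[F0 Fnd Fc]]; split.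
- by move=> t t0; apply: F0; rewrite in_itv/= t0.
- move=> s t s0 st.
  by apply: Fnd => //; rewrite in_itv/= ?s0 ?(le_trans s0 st).
- move=> p s t p0 p1 s0 t0.
  have sD : (s : R^o) \in `[0, +oo[%classic by rewrite inE/= in_itv/= s0.
  have tD : (t : R^o) \in `[0, +oo[%classic by rewrite inE/= in_itv/= t0.
  have : - F (p * s + (1 - p) * t) <= p * - F s + (1 - p) * - F t.
    exact: (Fc (Itv01 p0 p1) s t sD tD).
  by lra.
- by move=> t; rewrite in_itv/= andbT; exact: F0.
- by move=> s t; rewrite !in_itv/= !andbT => s0 _; exact: Fnd.
- move=> p s t; rewrite !inE/= !in_itv/= !andbT => s0 t0.
  have p0 : 0 <= p%:num by [].
  have p1 : p%:num <= 1 by [].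
  suff : - F (p%:num * s + (1 - p%:num) * t) <=
    p%:num * - F s + (1 - p%:num) * - F t by [].
  by have := Fc p%:num s t p0 p1 s0 t0; lra.
Qed.

(** Concavity of [G] bounds the average of the values by [G] at an average of values of [F];
    concavity of [F] then enlarges that argument, and [G] is monotone. *)
Lemma nondecreasing_concave_comp (R : realType) (G F : R -> R) :
  nondecreasing_concave G -> nondecreasing_concave F ->
  nondecreasing_concave (fun t => G (F t)).
Proof.
move=> /nondecreasing_concaveP[G0 Gnd Gc] /nondecreasing_concaveP[F0 Fnd Fc].
apply/nondecreasing_concaveP; split.
- by move=> t t0; exact/G0/F0.
- by move=> s t s0 st; apply: Gnd; [exact: F0|exact: Fnd].
- move=> p s t p0 p1 s0 t0.
  apply: le_trans (Gc _ _ _ p0 p1 (F0 _ s0) (F0 _ t0)) _.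
  apply: Gnd; last exact: Fc.
  by rewrite addr_ge0// mulr_ge0 ?subr_ge0// F0.
Qed.

Section sup_convolution.
Variables (R : realType) (F : R -> R) (c : R).
Hypotheses (Fnc : nondecreasing_concave F) (c_ge0 : 0 <= c).

Let S (t : R) := [set F (t - tau) + c * tau | tau in `[0, t]%classic].

Lemma le_sup_convolution (t tau : R) :
  0 <= tau -> tau <= t -> F (t - tau) + c * tau <= sup (S t).
Proof.
have [_ Fnd _] := (nondecreasing_concaveP F).1 Fnc.
move=> tau0 taut; apply: ub_le_sup; last first.
  by exists tau => //=; rewrite in_itv/= tau0 taut.
(* The real-valued [sup] is a true supremum only for bounded sets. Here the two terms are bounded
   separately, the first at [v = 0] and the second at [v = t]. *)
exists (F t + c * t) => _ [v /= + <-]; rewrite in_itv/= => /andP[v0 vt].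
by rewrite lerD ?ler_wpM2l// Fnd// ?subr_ge0// lerBlDr lerDl.
Qed.

Lemma sup_convolution_le (t M : R) : 0 <= t ->
  (forall tau, 0 <= tau -> tau <= t -> F (t - tau) + c * tau <= M) ->
  sup (S t) <= M.
Proof.
move=> t0 tM; apply: ge_sup.
  by exists (F (t - 0) + c * 0); exists 0 => //=; rewrite in_itv/= lexx t0.
by move=> _ [v /= + <-]; rewrite in_itv/= => /andP[]; exact: tM.
Qed.

Lemma nondecreasing_concave_sup_convolution :
  nondecreasing_concave (fun t => sup (S t)).
Proof.
have [F0 Fnd Fc] := (nondecreasing_concaveP F).1 Fnc.
apply/nondecreasing_concaveP; split.
- move=> t t0; apply: le_trans (le_sup_convolution (lexx 0) t0).
  by rewrite mulr0 addr0 subr0 F0.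
(* Any [v] admissible for [s] is admissible for [t], where it gives a larger value. *)
- move=> s t s0 st; apply: sup_convolution_le => // v v0 vs.
  apply: le_trans (le_sup_convolution v0 (le_trans vs st)).
  by rewrite lerD2r Fnd ?subr_ge0// lerD2r.
(* The endpoints [p = 0] and [p = 1] are trivial; removing them allows division by both weights
   below. *)
- move=> p s t; rewrite le_eqVlt => /predU1P[<- _ _ _|p0].
    by rewrite !mul0r !add0r subr0 !mul1r.
  rewrite le_eqVlt => /predU1P[-> _ _|p1 s0 t0].
    by rewrite subrr !mul0r !addr0 !mul1r.
  have q0 : 0 < 1 - p by rewrite subr_gt0.
  (* Bounding each supremum in turn by the remaining terms avoids choosing
     near-maximizers. *)
  rewrite -lerBrDr -ler_pdivlMl//.
  apply: sup_convolution_le => // u u0 us.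
  rewrite ler_pdivlMl// lerBrDr addrC -lerBrDr -ler_pdivlMl//.
  apply: sup_convolution_le => // v v0 vt.
  rewrite ler_pdivlMl// lerBrDr.
  (* The same convex combination of [u] and [v] is admissible at the combined point: the linear term
     splits exactly, and concavity of [F] handles the rest. *)
  have w0 : 0 <= p * u + (1 - p) * v.
    by rewrite addr_ge0// mulr_ge0// ltW.
  have wt : p * u + (1 - p) * v <= p * s + (1 - p) * t.
    by rewrite lerD// ler_wpM2l// ltW.
  apply: le_trans (le_sup_convolution w0 wt).
  have su : 0 <= s - u by rewrite subr_ge0.
  have tv : 0 <= t - v by rewrite subr_ge0.
  have := Fc p (s - u) (t - v) (ltW p0) (ltW p1) su tv.
  have -> : p * (s - u) + (1 - p) * (t - v) =
    p * s + (1 - p) * t - (p * u + (1 - p) * v) by lra.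
  by lra.
Qed.

End sup_convolution.

Lemma adversarial_score_le (R : realType) (V W : zmodType)
    (normV : V -> R) (normW : W -> R) (U : set V) (f : V -> W) (F : R -> R)
    (x x' : V) (t : R) :
  adversarial_score normV normW U f F -> U x -> U x' -> 0 <= t ->
  normV (x' - x) <= t -> normW (f x' - f x) <= F t.
Proof.
move=> [_ FP] Ux Ux' t0 xt; rewrite -lee_fin.
apply: le_trans (FP t t0).
apply: le_trans (ereal_sup_ubound _); last by exists x.
by apply: ereal_sup_ubound; exists x'.
Qed.

(** Both parts end here: [M] is [F_theta t] for infinite [kappa] and the supremum for finite
    [kappa]. *)
Lemma loss_le (R : realType) (n : nat)
    (f : 'rV[R]_n -> R) (gamma Gamma : R -> R) (z z' : 'rV[R]_n * R) (M : R) :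
  adversarial_score (@Num.norm R R) (@Num.norm R R) `[0, +oo[%classic
    gamma Gamma ->
  `|f z'.1 - f z.1| + `|z'.2 - z.2| <= M ->
  `|loss gamma f z' - loss gamma f z| <= Gamma M.
Proof.
move=> sG zM; apply: (adversarial_score_le sG); rewrite /= ?in_itv/= ?normr_ge0//.
  by apply: le_trans zM; rewrite addr_ge0.
apply: le_trans zM; apply: le_trans (ler_dist_dist _ _) _.
have -> : z'.2 - f z'.1 - (z.2 - f z.1) =
  (z'.2 - z.2) - (f z'.1 - f z.1) by lra.
by rewrite [leRHS]addrC; exact: ler_normB.
Qed.

Theorem proposition3 (R : realType) (n : nat)
    (X : set 'rV[R]_n) (Y : set R) (r kappa : \bar R)
    (f_theta : 'rV[R]_n -> R) (gamma F_theta Gamma : R -> R)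
    (r_ge1 : (1 <= r)%E) (kappa_gt0 : (0 < kappa)%E)
    (gamma_ge0 : {in `[0, +oo[, forall u : R, 0 <= gamma u})
    (scoreF : adversarial_score (@rnorm R n r) (@Num.norm R R)
                X f_theta F_theta)
    (scoreG : adversarial_score (@Num.norm R R) (@Num.norm R R)
                `[0, +oo[%classic gamma Gamma) :
  (kappa = +oo%E ->
     adversarial_loss_score (zdist r kappa) (X `*` Y) (loss gamma f_theta)
       (fun t => Gamma (F_theta t))) /\
  ((kappa < +oo)%E ->
     adversarial_loss_score (zdist r kappa) (X `*` Y) (loss gamma f_theta)
       (fun t => Gamma (sup [set F_theta (t - tau) + (fine kappa)^-1 * tau
                            | tau in `[0, t]%classic]))).
Proof.
have [[Fnc _] [Gnc _]] := (scoreF, scoreG).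
split=> [kappaE|kappay].
  split; first exact: nondecreasing_concave_comp.
  move=> t t0; apply: ge_ereal_sup => _ [[z' z] /= [[Xz' _] [Xz _] + ] <-].
  rewrite /zdist kappaE/= lee_fin.
  (* Distinct labels would put the pair at infinite distance, contradicting the bound by [t]. *)
  have [yE|neq] := eqVneq z'.2 z.2; last first.
    by rewrite gt0_mulye ?lte_fin ?normr_gt0 ?subr_eq0.
  rewrite yE subrr normr0 mule0 adde0 lee_fin => zt.
  apply: loss_le scoreG _.
  by rewrite yE subrr normr0 addr0; exact: adversarial_score_le scoreF _ _ t0 zt.
case: kappa kappa_gt0 kappay => // k; rewrite lte_fin => k0 _ /=.
have ki0 : 0 <= k^-1 by rewrite invr_ge0 ltW.
split.
  exact: nondecreasing_concave_comp Gnc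
    (nondecreasing_concave_sup_convolution Fnc ki0).
move=> t t0; apply: ge_ereal_sup => _ [[z' z] /= [[Xz' _] [Xz _] + ] <-].
rewrite /zdist/= -EFinM -EFinD !lee_fin => zt.
set tau := k * `|z'.2 - z.2| in zt.
have tau0 : 0 <= tau by rewrite mulr_ge0// ltW.
have taut : tau <= t by apply: le_trans zt; rewrite lerDr rnorm_ge0.
apply: loss_le scoreG _.
apply: le_trans (le_sup_convolution Fnc ki0 tau0 taut).
(* Since [k^-1 * tau] is exactly the label difference, it cancels, leaving the score of [f_theta] at
   radius [t - tau]. *)
rewrite mulKf ?gt_eqF// lerD2r.
by apply: (adversarial_score_le scoreF); rewrite ?subr_ge0// lerBrDr.
Qed.
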